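(* Let $a>0$ and $\epsilon\in[0,\tfrac12]$ be fixed with $a(\sqrt{1-\epsilon}-\sqrt\epsilon)^2<1$, and consider the binary censored block model with $p=a\log n/n$ in which $\sigma^*$ is chosen uniformly at random from $\{\pm1\}^n$. Then for any sequence of estimators $\widehat Y_n$ (functions of $A$), $\mathbb P\{\widehat Y_n=Y^*\}\to0$ as $n\to\infty$.
   Context: Binary censored block model: $G\sim\mathcal G(n,p)$ (Erdős–Rényi, independent of $\sigma^*$); each edge $(i,j)$ independently gets label $L_{ij}=\sigma^*_i\sigma^*_j$ with probability $1-\epsilon$ and $L_{ij}=-\sigma^*_i\sigma^*_j$ with probability $\epsilon$. $A$ is the symmetric weighted adjacency matrix with $A_{ij}=L_{ij}$ on edges and $0$ otherwise. $Y^*=\sigma^*(\sigma^* )^\top$. *)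

(* Defs.v *)
From mathcomp Require Import all_boot.
From Stdlib Require Import Reals.
Set Implicit Arguments. Unset Strict Implicit. Unset Printing Implicit Defensive.

Definition sgnR (b : bool) : R := if b then 1%R else (-1)%R.

Definition Ystar n (sigma : {ffun 'I_n -> bool}) : 'I_n -> 'I_n -> R :=
  fun i j => (sgnR (sigma i) * sgnR (sigma j))%R.

(* An observation: for each ordered pair (i,j) with i<j, None = no edge,
   Some b = edge with label sgnR b.  Entries with i>=j must be None. *)
Definition obs n := {ffun 'I_n * 'I_n -> option bool}.

Definition adj n (o : obs n) : 'I_n -> 'I_n -> R :=
  fun i j =>
    match o (if (i < j)%N then (i, j) else (j, i)) with
    | None => 0%R
    | Some b => sgnR b
    end.

Definition edge_prob (a : R) (n : nat) : R := (a * ln (INR n) / INR n)%R.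

Definition lik (a eps : R) n (sigma : {ffun 'I_n -> bool}) (o : obs n) : R :=
  \big[Rmult/1%R]_(k : 'I_n * 'I_n)
    (if (k.1 < k.2)%N then
       match o k with
       | None => (1 - edge_prob a n)%R
       | Some b => (edge_prob a n *
                    (if b == (sigma k.1 == sigma k.2) then 1 - eps else eps))%R
       end
     else match o k with None => 1%R | Some _ => 0%R end).

Definition mx_eq_ind n (M N : 'I_n -> 'I_n -> R) : R :=
  \big[Rmult/1%R]_(k : 'I_n * 'I_n)
    (if Req_EM_T (M k.1 k.2) (N k.1 k.2) then 1%R else 0%R).

Definition prob_exact (a eps : R) n
    (Yhat : ('I_n -> 'I_n -> R) -> ('I_n -> 'I_n -> R)) : R :=
  \big[Rplus/0%R]_(sigma : {ffun 'I_n -> bool})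
    \big[Rplus/0%R]_(o : obs n)
      (/ (2 ^ n) * lik a eps sigma o * mx_eq_ind (Yhat (adj o)) (Ystar sigma))%R.

(* Main.v *)
(** Flipping the label of a vertex [i] does not decrease the likelihood as soon as
    [i] sees at least as many wrong as correct edge labels. The configurations
    obtained from an exactly recovered [sigma] by such flips are distinct and not
    recovered, so if [W] counts these vertices then [E (1_success * W) <= 1], and
    success is unlikely once [W] concentrates around a mean tending to infinity.
    Counting only vertices of a small set [U] (of size about [delta * n]) that have
    no edge into [U] makes two such events interact through a single edge, so the
    variance of [W] is explicit. The mean is bounded below by an exponential tilt
    that makes correct and wrong labels equally likely, followed by Chebyshev; the
    total mass of the tilt on a row is [(1 - p * (sqrt (1-eps) - sqrt eps)^2) ^ n],
    that is [n ^ (- a * (sqrt (1-eps) - sqrt eps)^2)] up to a factor [n ^ o(1)]. *)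

Require Import Defs.
From mathcomp Require Import all_boot all_order all_algebra.
From mathcomp Require Import ring zify Rstruct.
From mathcomp Require lra.
Set Implicit Arguments. Unset Strict Implicit. Unset Printing Implicit Defensive.
Import Order.TTheory GRing.Theory Num.Theory.
Local Open Scope ring_scope.

(** * Product measures *)

Section ProductExpectation.
Variables (R : comNzRingType) (J X : finType).
Implicit Types (q : J -> X -> R) (f g : {ffun J -> X} -> R).

Definition pexp q f : R := \sum_(o : {ffun J -> X}) (\prod_k q k (o k)) * f o.

Definition normalized q := forall k, \sum_x q k x = 1.

Lemma eq_pexp q f g : f =1 g -> pexp q f = pexp q g.
Proof. by move=> fg; apply: eq_bigr => o _; rewrite fg. Qed.

Lemma pexpZ q c f : pexp q (fun o => c * f o) = c * pexp q f.
Proof. by rewrite /pexp mulr_sumr; apply: eq_bigr => o _; rewrite mulrCA. Qed.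

Lemma pexp_sum q (I : finType) (P : pred I) (F : I -> {ffun J -> X} -> R) :
  pexp q (fun o => \sum_(i | P i) F i o) = \sum_(i | P i) pexp q (F i).
Proof.
by rewrite /pexp exchange_big /=; apply: eq_bigr => o _; rewrite mulr_sumr.
Qed.

Lemma pexpD q f g : pexp q (fun o => f o + g o) = pexp q f + pexp q g.
Proof. by rewrite /pexp -big_split; apply: eq_bigr => o _; rewrite mulrDr. Qed.

Lemma pexp_prod q (F : J -> X -> R) :
  pexp q (fun o => \prod_k F k (o k)) = \prod_k \sum_x q k x * F k x.
Proof.
rewrite bigA_distr_bigA; apply: eq_bigr => o _.
by rewrite -big_split.
Qed.

Lemma pexp_cst q c : normalized q -> pexp q (fun=> c) = c.
Proof.
move=> q1; have := pexp_prod q (fun _ _ => 1).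
under eq_pexp do rewrite big1_eq.
under eq_bigr => k _ do under eq_bigr do rewrite mulr1.
under eq_bigr => k _ do rewrite q1.
rewrite big1_eq => e1.
by rewrite (@eq_pexp _ _ (fun=> c * 1)) ?pexpZ ?e1 ?mulr1 // => o; rewrite mulr1.
Qed.

Lemma pexp_coord q k0 (f : X -> R) : normalized q ->
  pexp q (fun o => f (o k0)) = \sum_x q k0 x * f x.
Proof.
move=> q1; pose F k x := if k == k0 then f x else 1.
rewrite (@eq_pexp _ _ (fun o => \prod_k F k (o k))) => [|o]; last first.
  by rewrite (bigD1 k0) //= /F eqxx big1 ?mulr1 // => k /negPf->.
rewrite pexp_prod (bigD1 k0) //= [X in _ * X]big1 => [|k /negPf kk0]; last first.
  by rewrite -[RHS](q1 k); apply: eq_bigr => x _; rewrite /F kk0 mulr1.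
by rewrite mulr1; apply: eq_bigr => x _; rewrite /F eqxx.
Qed.

Lemma pexp_reindex q (t : J -> X -> X) f :
    (forall k, involutive (t k)) -> (forall k x, q k (t k x) = q k x) ->
  pexp q f = pexp q (fun o => f [ffun k => t k (o k)]).
Proof.
move=> tK qt; pose h (o : {ffun J -> X}) := [ffun k => t k (o k)].
have hK : involutive h by move=> o; apply/ffunP => k; rewrite !ffunE tK.
rewrite /pexp (reindex h) /=; last by exists h => o _; rewrite hK.
by apply: eq_bigr => o _; congr (_ * _); apply: eq_bigr => k _; rewrite ffunE qt.
Qed.

(* Exchanging the coordinates in [A] between two independent copies of the
   configuration preserves the product weight and turns [f o * g o'] into
   [f o * g o]. *)
Lemma pexp_indep q (A : pred J) f g : normalized q ->
    (forall o o' : {ffun J -> X}, (forall k, A k -> o k = o' k) -> f o = f o') ->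
    (forall o o' : {ffun J -> X}, (forall k, ~~ A k -> o k = o' k) -> g o = g o') ->
  pexp q (fun o => f o * g o) = pexp q f * pexp q g.
Proof.
move=> q1 fA gA.
pose mix (o o' : {ffun J -> X}) := [ffun k => if A k then o k else o' k].
pose h (u : {ffun J -> X} * {ffun J -> X}) := (mix u.1 u.2, mix u.2 u.1).
have hK : involutive h.
  by move=> [o o']; congr pair; apply/ffunP => k; rewrite !ffunE; case: (A k).
pose wt (o : {ffun J -> X}) := \prod_k q k (o k).
have -> : pexp q f * pexp q g =
    \sum_(u : {ffun J -> X} * {ffun J -> X}) wt u.1 * wt u.2 * (f u.1 * g u.2).
  rewrite /pexp mulr_suml.
  under eq_bigr => o _ do rewrite mulr_sumr.
  by rewrite pair_big /=; apply: eq_bigr => u _; rewrite mulrACA.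
rewrite (reindex h) /=; last by exists h => u _; rewrite hK.
transitivity (\sum_(u : {ffun J -> X} * {ffun J -> X})
    wt u.1 * wt u.2 * (f u.1 * g u.1)); last first.
  apply: eq_bigr => -[o o'] _ /=; congr (_ * _); last first.
    congr (_ * _); first by apply: fA => k Ak; rewrite ffunE Ak.
    by apply: gA => k /negPf Ak; rewrite ffunE Ak.
  rewrite /wt -!big_split; apply: eq_bigr => k _ /=.
  by rewrite !ffunE; case: (A k) => //; rewrite mulrC.
rewrite -(pair_bigA _ (fun o o' => wt o * wt o' * (f o * g o))) /=.
apply: eq_bigr => o _.
rewrite -mulr_suml -mulr_sumr; congr (_ * _).
rewrite -[LHS]mulr1; congr (_ * _).
rewrite -(pexp_cst 1 q1); apply: eq_bigr => o' _.
by rewrite mulr1.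
Qed.

End ProductExpectation.

(** * The second-moment method *)

Section Concentration.
Import lra.
Variables (R : realFieldType) (J X : finType) (q : J -> X -> R).
Hypotheses (q1 : normalized q) (q_ge0 : forall k x, 0 <= q k x).
Implicit Types f g : {ffun J -> X} -> R.

Lemma ler_pexp f g : (forall o, f o <= g o) -> pexp q f <= pexp q g.
Proof.
move=> fg; apply: ler_sum => o _; apply: ler_wpM2l => //.
by apply: prodr_ge0 => k _.
Qed.

(** Expanding the square, idempotence turns the diagonal into the mean; the off-diagonal bound is
    completed to the full squared mean by adding nonnegative diagonal terms. *)
Lemma second_moment_sum (I : finType) (U : pred I) (w : I -> {ffun J -> X} -> R)
    (c : R) : 0 <= c ->
    (forall i o, U i -> w i o * w i o = w i o) ->
    (forall i j, U i -> U j -> i != j ->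
       pexp q (fun o => w i o * w j o) <= c * (pexp q (w i) * pexp q (w j))) ->
  pexp q (fun o => (\sum_(i | U i) w i o) * (\sum_(i | U i) w i o)) <=
    pexp q (fun o => \sum_(i | U i) w i o)
    + c * (pexp q (fun o => \sum_(i | U i) w i o)
           * pexp q (fun o => \sum_(i | U i) w i o)).
Proof.
move=> c0 ww wij.
rewrite (@eq_pexp _ _ _ _ _ (fun o => \sum_(i | U i) \sum_(j | U j) w i o * w j o)); last first.
  by move=> o; rewrite mulr_suml; apply: eq_bigr => i _; rewrite mulr_sumr.
rewrite !pexp_sum mulr_suml mulr_sumr -big_split /=.
apply: ler_sum => i Ui.
rewrite pexp_sum (bigD1 i) //= lerD //.
  by rewrite le_eqVlt; apply/orP; left; apply/eqP/eq_pexp => o; rewrite ww.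
have w0 j : U j -> 0 <= pexp q (w j).
  move=> Uj; apply: sumr_ge0 => o _; apply: mulr_ge0; first exact: prodr_ge0.
  by rewrite -ww // -expr2 sqr_ge0.
rewrite mulr_sumr mulr_sumr [X in _ <= X](bigD1 i) //=.
rewrite -[X in X <= _]add0r lerD ?mulr_ge0 ?w0 //.
by apply: ler_sum => j /andP[Uj ji]; apply: wij => //; rewrite eq_sym.
Qed.

(* Pointwise, [T <= T * W / A + eta + (1 - W / A)^2 / (4 * eta)] with [A] the mean
   of [W], by AM-GM applied to [T * (1 - W / A)]. *)
Lemma event_le_second_moment (T W : {ffun J -> X} -> R) (c eta : R) :
    0 < eta -> 0 < pexp q W -> (forall o, 0 <= T o <= 1) ->
    pexp q (fun o => W o * W o) <= pexp q W + c * (pexp q W * pexp q W) ->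
  pexp q T <= pexp q (fun o => T o * W o) / pexp q W + eta
              + ((pexp q W)^-1 + (c - 1)) / (4 * eta).
Proof.
set A := pexp q W => eta0 A0 T01 W2.
pose V o := T o * W o / A + eta + (1 - W o / A) ^+ 2 / (4 * eta).
have TV o : T o <= V o.
  rewrite /V; case/andP: (T01 o) => T0 T1; move: (T o) (W o / A) T0 T1 (mulrA (T o) (W o) A^-1).
  move=> t y t0 t1 <-.
  have d0 : 0 < 4 * eta by lra.
  rewrite -subr_ge0 -(pmulr_lge0 _ d0).
  have -> : (t * y + eta + (1 - y) ^+ 2 / (4 * eta) - t) * (4 * eta) =
     (1 - y - 2 * eta * t) ^+ 2 + 4 * eta ^+ 2 * (1 - t ^+ 2).
    by field; lra.
  rewrite addr_ge0 ?sqr_ge0 // mulr_ge0 //; last by rewrite subr_ge0 expr_le1.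
  by rewrite mulr_ge0 // sqr_ge0.
apply: (le_trans (ler_pexp TV)).
pose d := (4 * eta)^-1.
rewrite (@eq_pexp _ _ _ _ _ (fun o => A^-1 * (T o * W o) + ((eta + d) +
    ((- 2 * d / A) * W o + d / A ^+ 2 * (W o * W o))))); last first.
  by move=> o; rewrite /V /d; field; lra.
rewrite pexpD pexpZ pexpD pexp_cst // pexpD !pexpZ -/A.
have d0 : 0 < d by rewrite invr_gt0; lra.
have := ler_wpM2l (ltW (divr_gt0 d0 (exprn_gt0 2 A0))) W2 => le2.
rewrite [A^-1 * _]mulrC -!addrA !lerD2l.
have -> : (A^-1 + (c - 1)) / (4 * eta)
    = d + (- 2 * d / A * A + d / A ^+ 2 * (A + c * (A * A))).
  by rewrite /d; field; lra.
by rewrite !lerD2l.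
Qed.

End Concentration.

(** * The block model *)

Section Edges.
Variable n : nat.
Implicit Types (i j : 'I_n) (k : 'I_n * 'I_n).

Definition edge i j := if (i < j)%N then (i, j) else (j, i).
(** The order condition keeps only positions that can carry an edge, so [edge i] and [other i] are
    inverse bijections between the vertices distinct from [i] and the positions incident to [i]. *)
Definition incident i k := (k.1 < k.2)%N && ((k.1 == i) || (k.2 == i)).
Definition other i k := if k.1 == i then k.2 else k.1.

Lemma edgeC i j : edge i j = edge j i.
Proof. by rewrite /edge; case: ltngtP => // /val_inj->. Qed.

Lemma edge_lt i j : j != i -> ((edge i j).1 < (edge i j).2)%N.
Proof. by rewrite /edge -val_eqE /=; case: (ltngtP i j). Qed.

Lemma edge_incident i j : j != i -> incident i (edge i j).
Proof.
by move=> ji; rewrite /incident edge_lt // /edge; case: ifP => _ /=; rewrite eqxx ?orbT.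
Qed.

Lemma other_edge i j : j != i -> other i (edge i j) = j.
Proof.
by move=> ji; rewrite /other /edge; case: (i < j)%N => /=; rewrite ?eqxx ?(negPf ji).
Qed.

Lemma edge_other i k : incident i k -> edge i (other i k) = k.
Proof.
case: k => a b; rewrite /incident /other /edge /=.
case: (eqVneq a i) => [-> /= /andP[->] //|ai] /andP[ab /= /eqP <-].
by rewrite ltnNge (ltnW ab).
Qed.

Lemma edge_inj i j l : j != i -> l != i -> edge i j = edge i l -> j = l.
Proof. by move=> ji li E; rewrite -(other_edge ji) E other_edge. Qed.

Lemma edge_ends i j : ((edge i j).1 == i) || ((edge i j).2 == i).
Proof. by rewrite /edge; case: ifP => _ /=; rewrite eqxx ?orbT. Qed.

Lemma edge_avoid i j l : l != i -> l != j ->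
  ~~ (((edge i j).1 == l) || ((edge i j).2 == l)).
Proof.
by move=> li lj; rewrite /edge; case: ifP; rewrite /= ![_ == l]eq_sym negb_or li lj.
Qed.

Lemma prod_incident (R : comNzRingType) i (F : 'I_n * 'I_n -> R) :
  \prod_k F k = (\prod_(k | ~~ incident i k) F k) * \prod_(j | j != i) F (edge i j).
Proof.
rewrite (bigID (incident i)) /= mulrC; congr (_ * _).
rewrite (reindex_onto (edge i) (other i)) /=; last by move=> k; apply: edge_other.
apply: eq_bigl => j; have [->|ji] := eqVneq j i; last first.
  by rewrite edge_incident // other_edge ?eqxx.
by rewrite /incident /edge ltnn /= ltnn.
Qed.

End Edges.

Section Labels.
Variable (R : comNzRingType).

(* Weight of an observed edge state [x] between vertices whose labels are equal
   iff [s]; [c1] is charged when the label is correct and [c2] when it is not. *)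
Definition label_weight (c0 c1 c2 : R) (s : bool) (x : option bool) : R :=
  match x with None => c0 | Some b => if b == s then c1 else c2 end.

Lemma sum_option_bool (f : option bool -> R) :
  \sum_x f x = f None + (f (Some true) + f (Some false)).
Proof.
rewrite (bigD1 None) //= (bigD1 (Some true)) //= (bigD1 (Some false)) //= big1 ?addr0 //.
by case=> [[]|].
Qed.

(** The remaining product charges [p] to either label, so it is common to the model, its flip and
    the tilt; comparing them reduces to comparing powers. *)
Lemma prod_label_weight (I : finType) (V : pred I) (c0 p c1 c2 : R)
    (s : I -> bool) (x : I -> option bool) :
  \prod_(j | V j) label_weight c0 (p * c1) (p * c2) (s j) (x j) =
  (\prod_(j | V j) label_weight c0 p p (s j) (x j)) *
  (c1 ^+ #|[pred j | V j && (x j == Some (s j))]| *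
   c2 ^+ #|[pred j | V j && (x j == Some (~~ s j))]|).
Proof.
rewrite -!prodr_const !big_mkcondr -!big_split /=; apply: eq_bigr => j _.
case: (x j) => [b|] /=; rewrite ?mulr1 //.
by case: b; case: (s j) => /=; rewrite ?mulr1 ?mul1r.
Qed.

End Labels.

(** * Likelihood, flips and bad vertices *)

Section BlockModel.
Variables (R : realFieldType) (n : nat) (p e : R).
Hypotheses (p_ge0 : 0 <= p) (p_le1 : p <= 1) (e_ge0 : 0 <= e) (e_le : e <= 1 - e).
Implicit Types (i j l : 'I_n) (k : 'I_n * 'I_n) (sigma : {ffun 'I_n -> bool}) (o : obs n).

Definition kern sigma k (x : option bool) : R :=
  if (k.1 < k.2)%N then
    label_weight (1 - p) (p * (1 - e)) (p * e) (sigma k.1 == sigma k.2) x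
  else (x == None)%:R.

Lemma kern_normalized sigma : normalized (kern sigma).
Proof.
move=> k; rewrite sum_option_bool /kern; case: ifP => _ /=; last first.
  by rewrite !addr0.
by case: (sigma k.1 == sigma k.2) => /=; ring.
Qed.

Lemma kern_ge0 sigma k x : 0 <= kern sigma k x.
Proof.
rewrite /kern; case: ifP => _; last by rewrite ler0n.
have e1 : 0 <= 1 - e by apply: le_trans e_le.
by case: x => [b|] /=; [case: ifP => _; rewrite mulr_ge0|rewrite subr_ge0].
Qed.

Lemma kern_edge sigma i j x : j != i ->
  kern sigma (edge i j) x =
  label_weight (1 - p) (p * (1 - e)) (p * e) (sigma i == sigma j) x.
Proof.
move=> ji; rewrite /kern edge_lt // /edge.
by case: (i < j)%N => //=; rewrite [sigma j == _]eq_sym.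
Qed.

Definition flip sigma i : {ffun 'I_n -> bool} :=
  [ffun j => if j == i then ~~ sigma j else sigma j].

Lemma flipK i : involutive (flip^~ i).
Proof. by move=> s; apply/ffunP => j; rewrite !ffunE; case: eqP; rewrite ?negbK. Qed.

Lemma kern_flip_nonincident sigma i k x : ~~ incident i k ->
  kern (flip sigma i) k x = kern sigma k x.
Proof.
rewrite /incident negb_and negb_or /kern; case: ifP => //= _ /andP[k1 k2].
by rewrite !ffunE (negPf k1) (negPf k2).
Qed.

Variable U : pred 'I_n.

(** Labels inside [U] are left out, so that for distinct vertices of [U] the counts read disjoint
    sets of coordinates. *)
Definition right sigma i o : nat :=
  #|[pred j | ~~ U j && (o (edge i j) == Some (sigma i == sigma j))]|.
Definition wrong sigma i o : nat :=
  #|[pred j | ~~ U j && (o (edge i j) == Some (sigma i != sigma j))]|.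
Definition detached i o : bool :=
  [forall j, (U j && (j != i)) ==> (o (edge i j) == None)].
Definition bad sigma i o : bool := detached i o && (right sigma i o <= wrong sigma i o)%N.

Lemma prod_row (c0 c1 c2 : R) sigma i o : U i ->
  \prod_(j | j != i) label_weight c0 (p * c1) (p * c2) (sigma i == sigma j) (o (edge i j)) =
  \prod_(j | U j && (j != i)) label_weight c0 (p * c1) (p * c2) (sigma i == sigma j) (o (edge i j)) *
  (\prod_(j | ~~ U j) label_weight c0 p p (sigma i == sigma j) (o (edge i j)) *
   (c1 ^+ right sigma i o * c2 ^+ wrong sigma i o)).
Proof.
move=> Ui; rewrite -prod_label_weight (bigID U) /=; congr (_ * _).
  by apply: eq_bigl => j; rewrite andbC.
by apply: eq_bigl => j; have [->|_] := eqVneq j i; rewrite ?Ui.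
Qed.

Lemma prod_row_detached (c0 c1 c2 : R) sigma i o : detached i o ->
  \prod_(j | U j && (j != i)) label_weight c0 c1 c2 (sigma i == sigma j) (o (edge i j)) =
  c0 ^+ #|[pred j | U j && (j != i)]|.
Proof.
move=> /forallP hd; rewrite -prodr_const; apply: eq_bigr => j Uj.
by have := hd j; rewrite Uj /= => /eqP->.
Qed.

Lemma swap_pow_le (r w : nat) : (r <= w)%N ->
  (1 - e) ^+ r * e ^+ w <= e ^+ r * (1 - e) ^+ w.
Proof.
move=> /subnKC <-; rewrite !exprD mulrCA.
have e1 : 0 <= 1 - e by apply: le_trans e_le.
by do 2![apply: ler_wpM2l; rewrite ?exprn_ge0 //]; rewrite lerXn2r.
Qed.

(** A flip at [i] alters only the row of [i], where it exchanges correct and wrong labels. The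
    absent edges into [U] weigh the same before and after, so [swap_pow_le] decides. *)
Lemma bad_flip_le sigma i o : U i -> bad sigma i o ->
  \prod_k kern sigma k (o k) <= \prod_k kern (flip sigma i) k (o k).
Proof.
move=> Ui /andP[hd rw].
rewrite !(prod_incident i) /=.
under [X in _ <= X * _]eq_bigr => k nk do rewrite kern_flip_nonincident //.
apply: ler_wpM2l; first by apply: prodr_ge0 => k _; apply: kern_ge0.
have -> : \prod_(j | j != i) kern (flip sigma i) (edge i j) (o (edge i j)) =
   \prod_(j | j != i) label_weight (1 - p) (p * e) (p * (1 - e))
      (sigma i == sigma j) (o (edge i j)).
  apply: eq_bigr => j ji; rewrite kern_edge // !ffunE eqxx (negPf ji).
  by case: (o _) => //= b; case: b; case: (sigma i); case: (sigma j).
have -> : \prod_(j | j != i) kern sigma (edge i j) (o (edge i j)) =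
   \prod_(j | j != i) label_weight (1 - p) (p * (1 - e)) (p * e)
      (sigma i == sigma j) (o (edge i j)).
  by apply: eq_bigr => j ji; rewrite kern_edge.
rewrite !(prod_row _ _ _ _ _ Ui) !prod_row_detached //.
have p1 : 0 <= 1 - p by rewrite subr_ge0.
apply: ler_wpM2l; first by rewrite exprn_ge0.
apply: ler_wpM2l; last exact: swap_pow_le.
by apply: prodr_ge0 => j _; case: (o _) => //= b; case: ifP.
Qed.

(* [bad] without its condition on the edge between [i] and [j]; for [i], [j] in [U]
   the events [bad_off sigma i j] and [bad_off sigma j i] are independent. *)
Definition bad_off sigma i j o : bool :=
  [forall l, (U l && (l != i) && (l != j)) ==> (o (edge i l) == None)]
  && (right sigma i o <= wrong sigma i o)%N.

Lemma badE sigma i j o : U j -> j != i ->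
  bad sigma i o = (o (edge i j) == None) && bad_off sigma i j o.
Proof.
move=> Uj ji; rewrite /bad /bad_off andbA; congr (_ && _).
apply/forallP/andP => [h|[oij /forallP h] l].
  split; first by have := h j; rewrite Uj ji.
  by apply/forallP => l; apply/implyP => /andP[Ul lj]; have := h l; rewrite Ul.
have [->|lj] := eqVneq l j; first by rewrite oij implybT.
by have := h l; rewrite lj andbT.
Qed.

(** The vertices counted by [right] and [wrong] lie outside [U], hence differ from both [i] and [j].
    This is the measurability needed for independence. *)
Lemma bad_off_ext sigma i j o o' : U i -> U j ->
    (forall l, l != i -> l != j -> o (edge i l) = o' (edge i l)) ->
  bad_off sigma i j o = bad_off sigma i j o'.
Proof.
move=> Ui Uj oo'; rewrite /bad_off; congr (_ && _).
  apply: eq_forallb => l; case: (eqVneq l i) => [->|li]; rewrite ?andbF //.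
  by case: (eqVneq l j) => [->|lj]; rewrite ?andbF // oo'.
have nU l : ~~ U l -> (l != i) && (l != j).
  by move=> nUl; apply/andP; split; apply: contraNneq nUl => ->.
rewrite /right /wrong; congr (_ <= _)%N; apply: eq_card => l; rewrite !inE;
  by case: (boolP (U l)) => //= /nU/andP[li lj]; rewrite oo'.
Qed.

(** Both events factor through the absence of the edge between [i] and [j], of probability [1 - p],
    times independent [bad_off] events. The joint probability pays [1 - p] once, the product of the
    probabilities twice. *)
Lemma bad_pair sigma i j : U i -> U j -> i != j ->
  (1 - p) * pexp (kern sigma) (fun o => (bad sigma i o)%:R * (bad sigma j o)%:R) =
  pexp (kern sigma) (fun o => (bad sigma i o)%:R)
  * pexp (kern sigma) (fun o => (bad sigma j o)%:R).
Proof.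
move=> Ui Uj ij; have ji : j != i by rewrite eq_sym.
pose E0 o : R := (o (edge i j) == None)%:R.
pose u i j o : R := (bad_off sigma i j o)%:R.
have bi o : (bad sigma i o)%:R = E0 o * u i j o.
  by rewrite (badE _ _ Uj ji) -mulnb natrM.
have bj o : (bad sigma j o)%:R = E0 o * u j i o.
  by rewrite (badE _ _ Ui ij) -mulnb natrM edgeC.
have q1 := kern_normalized sigma.
have EE : pexp (kern sigma) E0 = 1 - p.
  rewrite (pexp_coord _ (fun x => (x == None)%:R)) // sum_option_bool kern_edge //=.
  by rewrite !mulr0 !addr0 mulr1.
have off i' j' o o' : U i' -> U j' -> (forall k, k != edge i' j' -> o k = o' k) ->
    u i' j' o = u i' j' o'.
  move=> Ui' Uj' oo'; congr (_%:R); congr nat_of_bool.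
  apply: bad_off_ext => // l li lj; apply: oo'; apply/eqP => E.
  (* For [j' = i'] the position [edge i' j'] is diagonal, so it is not an edge to [l]. *)
  case: (eqVneq j' i') => [ji'|ji']; last by move: lj; rewrite (edge_inj li ji' E) eqxx.
  by have := edge_lt li; rewrite E /edge ji' ltnn /= ltnn.
have E0A o o' : (forall k, k == edge i j -> o k = o' k) -> E0 o = E0 o'.
  by move=> oo'; rewrite /E0 oo'.
rewrite (eq_pexp _ bi) (eq_pexp _ bj).
rewrite (@eq_pexp _ _ _ _ _ (fun o => E0 o * (u i j o * u j i o))); last first.
  move=> o; rewrite bi bj mulrACA; congr (_ * _).
  by rewrite /E0; case: eqP; rewrite ?mulr1 ?mulr0.
rewrite !(pexp_indep (f := E0) (A := pred1 (edge i j))) //; first last.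
- move=> o o' oo'; congr (_ * _); first exact: off.
  by apply: off => // k; rewrite edgeC; apply: oo'.
- by move=> o o'; apply: off.
- by move=> o o' oo'; apply: off => // k; rewrite edgeC; apply: oo'.
(* All coordinates read by [u i j] touch [i]; none of those read by [u j i] does. *)
rewrite (pexp_indep (A := fun k => (k.1 == i) || (k.2 == i))) //; first last.
- move=> o o' oo'; congr (_%:R); congr nat_of_bool.
  apply: bad_off_ext => // l lj li; apply: oo'.
  by apply: edge_avoid; rewrite // eq_sym.
- move=> o o' oo'; congr (_%:R); congr nat_of_bool.
  by apply: bad_off_ext => // l lj li; apply: oo'; apply: edge_ends.
by rewrite EE; ring.
Qed.

End BlockModel.

(** * Exponential tilting of a row *)

Section Tilting.
Variables (R : realFieldType) (n : nat) (p e s : R).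
Hypotheses (p_ge0 : 0 <= p) (p_le1 : p <= 1) (e_ge0 : 0 <= e) (e_le : e <= 1 - e).
Hypotheses (s_ge0 : 0 <= s).
Variables (sigma : {ffun 'I_n -> bool}) (U : pred 'I_n) (i : 'I_n).
Hypothesis Ui : U i.
Implicit Types (j l : 'I_n) (k : 'I_n * 'I_n) (o : obs n).

(** Total mass of an untilted entry with label weights [p * s]; for [s = sqrt (e * (1 - e))] it
    equals [1 - p * (sqrt (1 - e) - sqrt e) ^ 2]. *)
Let M : R := 1 - p + 2 * (p * s).
Hypothesis M_gt0 : 0 < M.

Definition tilt k (x : option bool) : R :=
  if incident i k then
    if U (other i k) then (x == None)%:R
    else M^-1 * label_weight (1 - p) (p * s) (p * s) true x
  else kern p e sigma k x.

Lemma tilt_normalized : normalized tilt.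
Proof.
move=> k; rewrite /tilt; case: (incident i k); last exact: (kern_normalized p e sigma k).
rewrite sum_option_bool; case: ifP => _ /=; first by rewrite !addr0.
have E (c : R) : c * (1 - p) + (c * (p * s) + c * (p * s)) = c * M by rewrite /M; ring.
by rewrite E mulVf ?gt_eqF.
Qed.

Lemma tilt_ge0 k x : 0 <= tilt k x.
Proof.
rewrite /tilt; case: ifP => _; last exact: kern_ge0.
case: ifP => _; first by rewrite ler0n.
rewrite mulr_ge0 ?invr_ge0 ?(ltW M_gt0) //.
by case: x => [b|] /=; rewrite ?if_same ?mulr_ge0 ?subr_ge0.
Qed.

(** The lower inequality is the one in [bad]; the upper one limits the surplus of wrong labels, and
    with it the loss in the change of measure. *)
Definition nearly_tied (K : nat) o : bool :=
  (right U sigma i o <= wrong U sigma i o <= right U sigma i o + K)%N.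

Lemma tilt_row_detached o : detached U i o ->
  \prod_(j | j != i) tilt (edge i j) (o (edge i j)) =
  M^-1 ^+ #|[pred j | ~~ U j]| *
  (\prod_(j | ~~ U j) label_weight (1 - p) p p (sigma i == sigma j) (o (edge i j)) *
   (s ^+ right U sigma i o * s ^+ wrong U sigma i o)).
Proof.
move=> /forallP hd; rewrite -prod_label_weight -prodr_const (bigID U) /=.
rewrite big1 ?mul1r => [|j /andP[ji Uj]]; last first.
  have := hd j; rewrite Uj ji /= => /eqP->.
  by rewrite /tilt edge_incident // other_edge // Uj.
rewrite -big_split /=; apply: eq_big => j.
  by rewrite inE; have [->|_] := eqVneq j i; rewrite ?Ui.
move=> /andP[ji nUj]; rewrite /tilt edge_incident // other_edge // (negPf nUj).
by case: (o _) => //= b; rewrite !if_same.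
Qed.

(* Exponential change of measure on the row of [i], with both labels given the
   weight [p * s]; on [nearly_tied K] the density is controlled by [B]. *)
Lemma tilt_le (K : nat) (B : R) o : 0 <= B ->
    (forall a b : nat, (a <= b <= a + K)%N ->
       B * (s ^+ a * s ^+ b) <= (1 - e) ^+ a * e ^+ b) ->
  (1 - p) ^+ #|[pred j | U j && (j != i)]| * M ^+ #|[pred j | ~~ U j]| * B *
    (\prod_k tilt k (o k) * (nearly_tied K o)%:R)
  <= \prod_k kern p e sigma k (o k) * (bad U sigma i o)%:R.
Proof.
move=> B0 hB.
have rhs0 : 0 <= \prod_k kern p e sigma k (o k) * (bad U sigma i o)%:R.
  by apply: mulr_ge0; rewrite ?ler0n ?prodr_ge0 // => k _; apply: kern_ge0.
case: (boolP (nearly_tied K o)) => [tied|_]; last by rewrite !mulr0.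
(* A configuration that is not detached has tilted weight zero. *)
case: (boolP (detached U i o)) => [hd|]; last first.
  rewrite negb_forall => /existsP[j]; rewrite negb_imply => /andP[/andP[Uj ji] oj].
  rewrite (bigD1 (edge i j)) //= {1}/tilt edge_incident // other_edge // Uj.
  by rewrite (negPf oj) !mul0r mulr0.
have -> : bad U sigma i o by rewrite /bad hd; case/andP: tied.
rewrite !mulr1 !(prod_incident i) /=.
rewrite (eq_bigr (fun k => kern p e sigma k (o k))); last first.
  by move=> k /negPf nk; rewrite /tilt nk.
rewrite tilt_row_detached // [X in _ <= _ * X](eq_bigr (fun j =>
  label_weight (1 - p) (p * (1 - e)) (p * e) (sigma i == sigma j) (o (edge i j)))); last first.
  by move=> j ji; rewrite kern_edge.
rewrite (prod_row _ _ _ _ _ _ Ui) prod_row_detached //.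
set rest := \prod_(k | _) kern p e sigma k (o k).
set base := \prod_(j | ~~ U j) label_weight _ _ _ (sigma i == sigma j) (o (edge i j)).
set u := (1 - p) ^+ _; set v := #|_|.
have -> : u * M ^+ v * B * (rest * (M^-1 ^+ v * (base *
   (s ^+ right U sigma i o * s ^+ wrong U sigma i o)))) =
   rest * (u * (base * (B * (s ^+ right U sigma i o * s ^+ wrong U sigma i o)))).
  transitivity ((M ^+ v * M^-1 ^+ v) * (rest * (u * (base *
    (B * (s ^+ right U sigma i o * s ^+ wrong U sigma i o)))))).
    by ring.
  by rewrite -exprMn mulfV ?gt_eqF // expr1n mul1r.
have p1 : 0 <= 1 - p by rewrite subr_ge0.
apply: ler_wpM2l; first by apply: prodr_ge0 => k _; apply: kern_ge0.
apply: ler_wpM2l; first by rewrite exprn_ge0.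
apply: ler_wpM2l; last exact: hB.
by apply: prodr_ge0 => j _; case: (o _) => //= b; case: ifP.
Qed.

Definition label_sign j o : R :=
  label_weight 0 (-1) 1 (sigma i == sigma j) (o (edge i j)).

Lemma sum_label_sign o :
  \sum_(j | ~~ U j) label_sign j o = (wrong U sigma i o)%:R - (right U sigma i o)%:R.
Proof.
rewrite /wrong /right -!sum1_card !natr_sum !big_mkcondr -sumrB.
apply: eq_bigr => j _; rewrite /label_sign.
case: (o (edge i j)) => [b|] /=; last by rewrite subr0.
by case: b; case: (sigma i == sigma j); rewrite /= ?subr0 ?sub0r.
Qed.

(** On entries incident to [i] the tilted weight ignores the value of the label, so negating any set
    of them preserves the law. A single edge gives uncorrelated signs; the whole row exchanges
    [right] and [wrong]. *)
Lemma tilt_negate (A : pred ('I_n * 'I_n)) (f : obs n -> R) :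
    (forall k, A k -> incident i k) ->
  pexp tilt f = pexp tilt (fun o => f [ffun k => if A k then omap negb (o k) else o k]).
Proof.
move=> Ai; rewrite (@pexp_reindex _ _ _ _ (fun k x => if A k then omap negb x else x)) //.
  by move=> k [b|]; case: (A k); rewrite //= negbK.
move=> k x; case: (boolP (A k)) => // /Ai ik; rewrite /tilt ik.
by case: x => [b|] //=; rewrite !if_same.
Qed.

(* Negating the single label on [edge i j] reverses the sign of the expectation. *)
Lemma tilt_sign_cov j l : ~~ U j -> ~~ U l -> j != l ->
  pexp tilt (fun o => label_sign j o * label_sign l o) = 0.
Proof.
have nUi m : ~~ U m -> m != i by apply: contraNneq => ->.
move=> /nUi ji /nUi li jl; set f := (fun o => _).
suff E : pexp tilt f = - pexp tilt f.
  by apply/eqP; rewrite -eqNr -E.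
rewrite [LHS](tilt_negate (A := pred1 (edge i j))) => [|k /eqP->]; last first.
  exact: edge_incident.
rewrite -mulN1r -pexpZ; apply: eq_pexp => o.
rewrite /f /label_sign !ffunE /= eqxx.
have -> : (edge i l == edge i j) = false.
  by apply: contra_neqF jl => /eqP E; rewrite (edge_inj ji li).
case: (o (edge i j)) => [b|] /=; last by ring.
by case: b; case: (sigma i == sigma j) => /=; ring.
Qed.

Lemma tilt_sign_var j : ~~ U j ->
  pexp tilt (fun o => label_sign j o * label_sign j o) = 2 * (p * s) / M.
Proof.
move=> nUj; have ji : j != i by apply: contraNneq nUj => ->.
rewrite (pexp_coord _ (fun x => label_weight 0 (-1) 1 (sigma i == sigma j) x
   * label_weight 0 (-1) 1 (sigma i == sigma j) x)); last exact: tilt_normalized.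
rewrite sum_option_bool /tilt edge_incident // other_edge // (negPf nUj) /=.
by case: (sigma i == sigma j) => /=; ring.
Qed.

(** By symmetry, twice the probability accounts for both signs of the difference [D] of the counts,
    so it is at least the probability that [D] is at most [K] in absolute value; Chebyshev bounds
    that. *)
Lemma tilt_nearly_tied (K : nat) : (0 < K)%N ->
  1 - #|[pred j | ~~ U j]|%:R * (2 * (p * s) / M) / K%:R ^+ 2 <=
  2 * pexp tilt (fun o => (nearly_tied K o)%:R).
Proof.
move=> K0; pose D o := \sum_(j | ~~ U j) label_sign j o.
have ED : pexp tilt (fun o => D o * D o) = #|[pred j | ~~ U j]|%:R * (2 * (p * s) / M).
  rewrite (@eq_pexp _ _ _ _ _ (fun o => \sum_(j | ~~ U j) \sum_(l | ~~ U l)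
    label_sign j o * label_sign l o)); last first.
    by move=> o; rewrite /D mulr_suml; apply: eq_bigr => j _; rewrite mulr_sumr.
  rewrite pexp_sum mulr_natl -sumr_const; apply: eq_bigr => j nUj.
  rewrite pexp_sum (bigD1 j) //= tilt_sign_var // big1 ?addr0 // => l /andP[nUl lj].
  by rewrite tilt_sign_cov // eq_sym.
rewrite [X in _ <= X]mulr_natl mulr2n [X in _ <= _ + X](@tilt_negate (incident i)) //.
rewrite -pexpD.
(* Chebyshev pointwise: [1 - D ^ 2 / K ^ 2] never exceeds 1 and is nonpositive once [D] leaves the
   window. *)
have -> : 1 - #|[pred j | ~~ U j]|%:R * (2 * (p * s) / M) / K%:R ^+ 2 =
    pexp tilt (fun o => 1 + (- (K%:R ^+ 2)^-1) * (D o * D o)).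
  by rewrite pexpD pexpZ ED (pexp_cst _ tilt_normalized); ring.
apply: ler_pexp; first exact: tilt_ge0.
move=> o; set o' := finfun _.
have nUi j : ~~ U j -> j != i by apply: contraNneq => ->.
have rw' : right U sigma i o' = wrong U sigma i o.
  apply: eq_card => j; rewrite !inE; case: (boolP (U j)) => //= /nUi ji.
  rewrite ffunE edge_incident //; case: (o (edge i j)) => [b|] //=.
  by case: b; case: (sigma i == sigma j).
have wr' : wrong U sigma i o' = right U sigma i o.
  apply: eq_card => j; rewrite !inE; case: (boolP (U j)) => //= /nUi ji.
  rewrite ffunE edge_incident //; case: (o (edge i j)) => [b|] //=.
  by case: b; case: (sigma i == sigma j).
rewrite /nearly_tied rw' wr' /D sum_label_sign.
move: (right _ _ _ _) (wrong _ _ _ _) => r w.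
have Kp : 0 < K%:R ^+ 2 :> R by rewrite exprn_gt0 ?ltr0n.
have far (a b : nat) : (a + K < b)%N ->
    1 + - (K%:R ^+ 2)^-1 * ((b%:R - a%:R) * (b%:R - a%:R)) <= (0 : R).
  move=> lt; rewrite mulNr subr_le0 mulrC ler_pdivlMr // mul1r -expr2.
  rewrite ler_pXn2r ?nnegrE ?subr_ge0 ?ler_nat ?ler0n //; last by lia.
  by rewrite lerBrDl -natrD ler_nat ltnW.
have near : 1 + - (K%:R ^+ 2)^-1 * ((w%:R - r%:R) * (w%:R - r%:R)) <= (1 : R).
  by rewrite gerDl mulNr oppr_le0 mulr_ge0 ?invr_ge0 ?(ltW Kp) // -expr2 sqr_ge0.
case: (leqP r w) => rw; case: (leqP w (r + K)) => wK /=; rewrite ?add0r.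
- by apply: (le_trans near); rewrite lerDl ler0n.
- by apply: (le_trans (far _ _ wK)); rewrite ler0n.
- case: (leqP r (w + K)) => rK; first by rewrite (ltnW rw).
  rewrite andbF -[X in _ * X]mulrNN !opprB; exact: far.
- by lia.
Qed.

Lemma bad_lower_bound (K : nat) (B : R) : (0 < K)%N -> 0 <= B ->
    (forall a b : nat, (a <= b <= a + K)%N ->
       B * (s ^+ a * s ^+ b) <= (1 - e) ^+ a * e ^+ b) ->
  (1 - p) ^+ #|[pred j | U j && (j != i)]| * M ^+ #|[pred j | ~~ U j]| * B *
    ((1 - #|[pred j | ~~ U j]|%:R * (2 * (p * s) / M) / K%:R ^+ 2) / 2)
  <= pexp (kern p e sigma) (fun o => (bad U sigma i o)%:R).
Proof.
move=> K0 B0 hB; set C := _ * _ * B.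
have C0 : 0 <= C.
  by rewrite !mulr_ge0 ?exprn_ge0 ?(ltW M_gt0) // subr_ge0.
apply: (@le_trans _ _ (C * pexp tilt (fun o => (nearly_tied K o)%:R))).
  by apply: ler_wpM2l => //; rewrite ler_pdivrMr // [X in _ <= X]mulrC; apply: tilt_nearly_tied.
by rewrite /pexp mulr_sumr; apply: ler_sum => o _; apply: tilt_le.
Qed.

End Tilting.

(** * Recovery versus flips *)

Section Success.
Variables (R : realFieldType) (n : nat) (p e : R).
Hypotheses (p_ge0 : 0 <= p) (p_lt1 : p < 1) (e_ge0 : 0 <= e) (e_le : e <= 1 - e).
Variables (U : pred 'I_n) (T : {ffun 'I_n -> bool} -> obs n -> R).
Hypothesis T01 : forall sigma o, 0 <= T sigma o <= 1.
Hypothesis T_flip : forall sigma o, \sum_(i | U i) T (flip sigma i) o <= 1.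

Let W sigma (o : obs n) : R := \sum_(i | U i) (bad U sigma i o)%:R.

(** On a bad vertex the likelihood of [sigma] is at most that of its flip. Reindexing by the
    involution [flip] moves the flip onto [T], where [T_flip] applies for each [sigma]. *)
Lemma success_mean_bad :
  \sum_sigma pexp (kern p e sigma) (fun o => T sigma o * W sigma o) <= 2 ^+ n.
Proof.
have p1 := ltW p_lt1.
pose P sigma (o : obs n) := \prod_k kern p e sigma k (o k).
have P0 sigma o : 0 <= P sigma o by apply: prodr_ge0 => k _; apply: kern_ge0.
have step : \sum_sigma pexp (kern p e sigma) (fun o => T sigma o * W sigma o)
    <= \sum_sigma \sum_(o : obs n) \sum_(i | U i) P (flip sigma i) o * T sigma o.
  apply: ler_sum => sigma _; apply: ler_sum => o _.
  rewrite /W !mulr_sumr; apply: ler_sum => i Ui.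
  have /andP[T0 _] := T01 sigma o.
  rewrite mulrCA mulrC; apply: ler_wpM2r => //.
  case: (boolP (bad U sigma i o)) => [b|_]; last by rewrite mulr0.
  by rewrite mulr1; apply: bad_flip_le b.
apply: (le_trans step).
have -> : \sum_sigma \sum_(o : obs n) \sum_(i | U i) P (flip sigma i) o * T sigma o =
    \sum_sigma \sum_(o : obs n) P sigma o * \sum_(i | U i) T (flip sigma i) o.
  rewrite exchange_big [RHS]exchange_big; apply: eq_bigr => o _.
  under [RHS]eq_bigr do rewrite mulr_sumr.
  rewrite exchange_big [RHS]exchange_big; apply: eq_bigr => i _.
  rewrite (reindex ((@flip n)^~ i)) /=; last by exists ((@flip n)^~ i) => s _; apply: flipK.
  by apply: eq_bigr => s _; rewrite flipK.
have -> : 2 ^+ n = \sum_(sigma : {ffun 'I_n -> bool}) (1 : R).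
  by rewrite sumr_const card_ffun card_bool card_ord natrX.
apply: ler_sum => sigma _.
rewrite -(pexp_cst 1 (kern_normalized p e sigma)).
by apply: ler_sum => o _; apply: ler_wpM2l.
Qed.

(** For each [sigma], the second-moment bound applies with [c = 1 / (1 - p)] from [bad_pair], whence
    [c - 1 = p / (1 - p)]; averaging over [sigma] then uses [success_mean_bad]. *)
Lemma success_le (L eta : R) : 0 < eta -> 0 < L -> (0 < #|U|)%N ->
    (forall sigma i, U i -> L <= pexp (kern p e sigma) (fun o => (bad U sigma i o)%:R)) ->
  (2 ^+ n)^-1 * (\sum_sigma pexp (kern p e sigma) (T sigma))
  <= (#|U|%:R * L)^-1 + eta + ((#|U|%:R * L)^-1 + p / (1 - p)) / (4 * eta).
Proof.
move=> eta0 L0 U0 hL; set A := #|U|%:R * L.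
have A0 : 0 < A by rewrite mulr_gt0 ?ltr0n.
have p1 := ltW p_lt1.
have q0 : 0 < 1 - p by rewrite subr_gt0.
have EW sigma : A <= pexp (kern p e sigma) (W sigma).
  rewrite pexp_sum /A mulr_natl -sumr_const.
  by apply: ler_sum => i Ui; apply: hL.
pose D := eta + (A^-1 + p / (1 - p)) / (4 * eta).
have step sigma : pexp (kern p e sigma) (T sigma) <=
    A^-1 * pexp (kern p e sigma) (fun o => T sigma o * W sigma o) + D.
  have q1 := kern_normalized p e sigma.
  have qp : forall k x, 0 <= kern p e sigma k x by move=> k x; apply: kern_ge0.
  have EW0 := lt_le_trans A0 (EW sigma).
  apply: (le_trans (event_le_second_moment q1 qp eta0 EW0 (T01 sigma) (c := (1 - p)^-1) _)).
    apply: second_moment_sum => //.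
    - by rewrite invr_ge0 ltW.
    - by move=> i o _; case: (bad _ _ _ _); rewrite ?mulr1 ?mulr0.
    - by move=> i j Ui Uj ij; rewrite -bad_pair // mulKf // gt_eqF.
  have inv : (pexp (kern p e sigma) (W sigma))^-1 <= A^-1 by rewrite lef_pV2 ?posrE.
  have -> : (1 - p)^-1 - 1 = p / (1 - p) by field; rewrite gt_eqF.
  rewrite /D addrA !lerD //.
    rewrite mulrC; apply: ler_wpM2r => //.
    apply: sumr_ge0 => o _; apply: mulr_ge0; first by apply: prodr_ge0.
    apply: mulr_ge0; first by case/andP: (T01 sigma o).
    by apply: sumr_ge0 => i _; rewrite ler0n.
  by apply: ler_wpM2r; rewrite ?lerD // invr_ge0 mulr_ge0 // ltW.
rewrite ler_pdivrMl ?exprn_gt0 //.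
apply: (le_trans (ler_sum _ (fun sigma _ => step sigma))).
rewrite big_split /= -mulr_sumr sumr_const card_ffun card_bool card_ord.
rewrite -[D *+ _]mulr_natl natrX -addrA -/D [X in _ <= X]mulrDr lerD2r [X in _ <= X]mulrC.
by apply: ler_wpM2l; [rewrite invr_ge0 ltW|apply: success_mean_bad].
Qed.

End Success.

(** * Success events of an estimator *)

Section Recovery.
Local Notation R := Rdefinitions.R.

Lemma likE (a eps : R) n (sigma : {ffun 'I_n -> bool}) (o : obs n) :
  lik a eps sigma o = \prod_k kern (edge_prob a n) eps sigma k (o k).
Proof.
apply: eq_bigr => k _; rewrite /kern; case: ifP => _; case: (o k) => //= b.
by case: (b == _).
Qed.

Lemma mx_eq_indP n (M N : 'I_n -> 'I_n -> R) :
  mx_eq_ind M N = 1 /\ (forall i j, M i j = N i j) \/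
  mx_eq_ind M N = 0 /\ exists i j, M i j <> N i j.
Proof.
pose P (k : 'I_n * 'I_n) := M k.1 k.2 == N k.1 k.2.
have E : mx_eq_ind M N = \prod_k (P k)%:R.
  by apply: eq_bigr => k _; rewrite /P; case: RIneq.Req_EM_T => /= [->|/eqP/negPf->]; rewrite ?eqxx.
case: (boolP [forall k, P k]) => [/forallP h|].
  left; split; first by rewrite E big1 // => k _; rewrite h.
  by move=> i j; apply/eqP/(h (i, j)).
rewrite negb_forall => /existsP[k nk]; right; split.
  by rewrite E (bigD1 k) //= (negPf nk) mul0r.
by exists k.1, k.2; apply/eqP.
Qed.

Lemma sgnR_neg b : sgnR (~~ b) = - sgnR b.
Proof. by case: b; rewrite /= ?opprK. Qed.

Lemma sgnR_neq0 b : sgnR b != 0.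
Proof. by case: b; rewrite /= ?oppr_eq0 oner_eq0. Qed.

(** If [Y] matched flips at distinct [i] and [j], its entry at [(i, v)] would equal its own
    opposite. The vertex [v], never flipped, excludes two flips that agree up to the global sign,
    which [Ystar] cannot see. *)
Lemma recovery_flip n (U : pred 'I_n) (v : 'I_n) (Y : 'I_n -> 'I_n -> R)
    (sigma : {ffun 'I_n -> bool}) : ~~ U v ->
  \sum_(i | U i) mx_eq_ind Y (Ystar (flip sigma i)) <= 1.
Proof.
move=> nUv; have nv i : U i -> (v == i) = false.
  by move=> Ui; apply: contraNF nUv => /eqP->.
case: (pickP (fun i => U i && (mx_eq_ind Y (Ystar (flip sigma i)) == 1))) => [i|h].
  move=> /andP[Ui /eqP Ei]; rewrite (bigD1 i) //= Ei big1 ?addr0 // => j /andP[Uj ji].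
  case: (mx_eq_indP Y (Ystar (flip sigma i))) => -[]; rewrite Ei => E1; last first.
    by move=> _; move: E1 => /eqP; rewrite oner_eq0.
  move=> Yi; case: (mx_eq_indP Y (Ystar (flip sigma j))) => -[] // _ Yj.
  have := Yi i v; rewrite Yj /Ystar !ffunE eqxx !nv // [i == j]eq_sym (negPf ji).
  rewrite sgnR_neg !RmultE mulNr => /eqP; rewrite eq_sym eqNr.
  by rewrite mulf_eq0 !(negPf (sgnR_neq0 _)).
rewrite big1 ?ler01 // => i Ui.
case: (mx_eq_indP Y (Ystar (flip sigma i))) => -[] // E1 _.
by have := h i; rewrite Ui E1 eqxx.
Qed.

Lemma prob_exact_le (a eps : R) n (U : pred 'I_n) (v : 'I_n)
    (Yhat : ('I_n -> 'I_n -> R) -> ('I_n -> 'I_n -> R)) (L eta : R) :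
    let p := edge_prob a n in
    0 <= p -> p < 1 -> 0 <= eps -> eps <= 1 - eps ->
    ~~ U v -> (0 < #|U|)%N -> 0 < eta -> 0 < L ->
    (forall sigma i, U i -> L <= pexp (kern p eps sigma) (fun o => (bad U sigma i o)%:R)) ->
  prob_exact a eps Yhat
  <= (#|U|%:R * L)^-1 + eta + ((#|U|%:R * L)^-1 + p / (1 - p)) / (4 * eta).
Proof.
move=> p p0 p1 e0 e1 nUv U0 eta0 L0 hL.
pose T sigma (o : obs n) : R := mx_eq_ind (Yhat (adj o)) (Ystar sigma).
have -> : prob_exact a eps Yhat =
    (2 ^+ n)^-1 * \sum_sigma pexp (kern p eps sigma) (T sigma).
  rewrite mulr_sumr; apply: eq_bigr => sigma _.
  rewrite mulr_sumr; apply: eq_bigr => o _.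
  by rewrite likE mulrA RpowE.
apply: success_le => //.
  move=> sigma o; rewrite /T.
  by case: (mx_eq_indP (Yhat (adj o)) (Ystar sigma)) => -[-> _]; rewrite ?lexx ler01.
by move=> sigma o; apply: (@recovery_flip _ _ v).
Qed.

End Recovery.

(** Meant for [u = sqrt eps] and [v = sqrt (1 - eps)]. With [w = r + d] the ratio of the two weights
    is [(u / v) ^ d], so [b = u / v] serves. *)
Lemma tie_density (R : realFieldType) (u v : R) : 0 <= u -> u <= v -> 0 < v ->
  exists2 b : R, 0 < b <= 1 & forall K r w : nat, (r <= w <= r + K)%N ->
    b ^+ K * ((u * v) ^+ r * (u * v) ^+ w) <= (v ^+ 2) ^+ r * (u ^+ 2) ^+ w.
Proof.
move=> u0 uv v0; have [u_eq0|un0] := eqVneq u 0.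
  (* For [u = 0] both sides vanish unless [w = 0], which forces [r = 0]. *)
  exists 1; first by rewrite ltr01 lexx.
  move=> K r [|w]; first by rewrite leqn0 => /andP[/eqP-> _]; rewrite !expr0 expr1n !mulr1.
  by move=> _; rewrite u_eq0 mul0r [0 ^+ 2]expr2 mul0r exprS !mul0r !mulr0.
have up : 0 < u by rewrite lt_def un0.
have b01 : 0 <= u / v <= 1 by rewrite ler_pdivrMr // mul1r uv divr_ge0 // ltW.
exists (u / v); first by rewrite divr_gt0 // ler_pdivrMr // mul1r.
move=> K r w /andP[/subnKC <-]; rewrite leq_add2l; move: (w - r)%N => d dK.
have -> : (v ^+ 2) ^+ r * (u ^+ 2) ^+ (r + d) =
    (u / v) ^+ d * ((u * v) ^+ r * (u * v) ^+ (r + d)).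
  rewrite !exprD; have -> : (u ^+ 2) ^+ d = (u / v) ^+ d * (u * v) ^+ d.
    by rewrite -exprMn; congr (_ ^+ d); field; rewrite gt_eqF.
  rewrite mulrA; have -> : (v ^+ 2) ^+ r * (u ^+ 2) ^+ r = (u * v) ^+ r * (u * v) ^+ r.
    by rewrite -!exprMn; congr (_ ^+ r); ring.
  by move: (_ ^+ d) (_ ^+ d) (_ ^+ r) => x y z; ring.
apply: ler_wpM2r; first by rewrite mulr_ge0 // exprn_ge0 // mulr_ge0 // ltW.
by case/andP: b01 => b0 b1; apply: ler_wiXn2l.
Qed.

(** * An explicit bound for given [n], [m] and [K] *)

Section ExactRecoveryBound.
Import lra.
Local Notation R := Rdefinitions.R.

Lemma prob_exact_ge0 (a eps : R) n (Yhat : ('I_n -> 'I_n -> R) -> ('I_n -> 'I_n -> R)) :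
  0 <= edge_prob a n -> edge_prob a n <= 1 -> 0 <= eps -> eps <= 1 - eps ->
  0 <= prob_exact a eps Yhat.
Proof.
move=> p0 p1 e0 e1; apply: sumr_ge0 => sigma _; apply: sumr_ge0 => o _.
apply: mulr_ge0; last first.
  by case: (mx_eq_indP (Yhat (adj o)) (Ystar sigma)) => -[-> _].
rewrite likE; apply: mulr_ge0; last by apply: prodr_ge0 => k _; apply: kern_ge0.
by rewrite RpowE; have : 0 <= ((2 : R) ^+ n)^-1 by rewrite invr_ge0 exprn_ge0.
Qed.

Lemma prob_exact_tilt_le (a eps s b eta : R) n m K
    (Yhat : ('I_n -> 'I_n -> R) -> ('I_n -> 'I_n -> R)) :
    let p := edge_prob a n in
    let M := 1 - p + 2 * (p * s) in
    let L := m%:R * ((1 - p) ^+ m * M ^+ n * b ^+ K / 4) in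
    0 <= p -> p < 1 -> 0 <= eps -> eps <= 1 - eps -> 0 <= s -> 2 * s <= 1 ->
    0 < b -> 0 < eta -> (0 < m < n)%N -> (0 < K)%N ->
    (forall r w : nat, (r <= w <= r + K)%N ->
       b ^+ K * (s ^+ r * s ^+ w) <= (1 - eps) ^+ r * eps ^+ w) ->
    n%:R * (2 * (p * s) / M) / K%:R ^+ 2 <= 1 / 2 ->
  prob_exact a eps Yhat <= L^-1 + eta + (L^-1 + p / (1 - p)) / (4 * eta).
Proof.
move=> p M L p0 p1 e0 e1 s0 s1 b0 eta0 /andP[m0 mn] K0 hb hK.
have n0 : (n.-1 < n)%N by case: (n) mn.
(* [U] consists of the first [m] vertices; since [m < n], the last vertex is outside and fixes the
   sign. *)
pose U := [pred i : 'I_n | (i < m)%N].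
have cU : #|U| = m.
  rewrite -sum1_card (big_ord_narrow (ltnW mn)) /= sum1_card card_ord //.
have p1' := ltW p1.
have q0 : 0 < 1 - p by rewrite subr_gt0.
have q1 : 1 - p <= 1 by rewrite gerBl.
have ps0 : 0 <= p * s by rewrite mulr_ge0.
have M0 : 0 < M by rewrite /M; lra.
have M1 : M <= 1.
  by have := ler_wpM2l p0 s1; rewrite /M mulrCA mulr1; lra.
have bK0 : 0 < b ^+ K by rewrite exprn_gt0.
have nUv : ~~ U (Ordinal n0) by rewrite /= -leqNgt -ltnS (ltn_predK mn).
have L0 : 0 < (1 - p) ^+ m * M ^+ n * b ^+ K / 4.
  by rewrite divr_gt0 ?ltr0n // !mulr_gt0 ?exprn_gt0.
have := @prob_exact_le a eps n U _ Yhat _ eta p0 p1 e0 e1 nUv _ eta0 L0.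
rewrite cU; apply=> // sigma i Ui.
apply: (le_trans _ (@bad_lower_bound _ _ _ _ _ p0 p1' e0 e1 s0 sigma U i Ui M0 K _ K0 (ltW bK0) hb)).
have cV : (#|[pred j | ~~ U j]| <= n)%N by rewrite -[X in (_ <= X)%N]card_ord max_card.
have cUi : (#|[pred j | U j && (j != i)]| <= m)%N.
  by rewrite -cU; apply/subset_leq_card/subsetP => j; rewrite !inE => /andP[].
have t0 : 0 <= 2 * (p * s) / M by rewrite mulr_ge0 ?invr_ge0 ?(ltW M0) // mulr_ge0 ?ler0n.
(* The Chebyshev error is at most 1/2, and the symmetry halves what is left. *)
have half : 1 / 4 <= (1 - #|[pred j | ~~ U j]|%:R * (2 * (p * s) / M) / K%:R ^+ 2) / 2.
  have : #|[pred j | ~~ U j]|%:R * (2 * (p * s) / M) / K%:R ^+ 2 <= 1 / 2.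
    apply: le_trans hK; apply: ler_wpM2r; first by rewrite invr_ge0 exprn_ge0.
    by apply: ler_wpM2r => //; rewrite ler_nat.
  move: (_ / K%:R ^+ 2) => y; lra.
rewrite -[X in X <= _]mulrA -[X in X <= _]mulrA -[X in _ <= X]mulrA -[X in _ <= X]mulrA.
have qm : (1 - p) ^+ m <= (1 - p) ^+ #|[pred j | U j && (j != i)]|.
  by apply: ler_wiXn2l; rewrite ?(ltW q0).
have Mn : M ^+ n <= M ^+ #|[pred j | ~~ U j]|.
  by apply: ler_wiXn2l; rewrite ?(ltW M0).
do 2![apply: ler_pM; rewrite ?mulr_ge0 ?exprn_ge0 ?(ltW q0) ?(ltW M0) ?(ltW b0) ?invr_ge0 //].
by apply: ler_wpM2l; rewrite ?(ltW bK0) // -[_^-1]mul1r.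
Qed.

End ExactRecoveryBound.

(** * Asymptotics *)

From Stdlib Require Import Reals Lra.
Local Open Scope R_scope.

Lemma prob_exact_tilt_leR (a eps s b eta : R) (n m K : nat)
    (Yhat : ('I_n -> 'I_n -> R) -> ('I_n -> 'I_n -> R)) :
    let p := edge_prob a n in
    let M := 1 - p + 2 * (p * s) in
    let L := INR m * ((1 - p) ^ m * M ^ n * b ^ K / 4) in
    0 <= p -> p < 1 -> 0 <= eps -> eps <= 1 - eps -> 0 <= s -> 2 * s <= 1 ->
    0 < b -> 0 < eta -> (0 < m < n)%nat -> (0 < K)%nat ->
    (forall r w : nat, (r <= w <= r + K)%nat ->
       b ^ K * (s ^ r * s ^ w) <= (1 - eps) ^ r * eps ^ w) ->
    INR n * (2 * (p * s) / M) / INR K ^ 2 <= 1 / 2 ->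
  prob_exact a eps Yhat <= / L + eta + (/ L + p / (1 - p)) / (4 * eta).
Proof.
move=> p M L p0 p1 e0 e1 s0 s1 b0 eta0 mn K0 hb hK.
have two : IZR 2 = (2%:R)%R by rewrite -INRE INR_IZR_INZ.
have four : IZR 4 = (4%:R)%R by rewrite -INRE INR_IZR_INZ.
have := @prob_exact_tilt_le a eps s b eta n m K Yhat.
move: hK; rewrite /L /M !INRE !RpowE two four -/p => /RleP hK.
move=> main; apply/RleP; apply: main => //; try exact/RleP; try exact/RltP.
by move=> r w rw; apply/RleP; rewrite -!RpowE; apply: hb.
Qed.

Lemma nat_floor (x : R) : 0 <= x -> exists m : nat, INR m <= x < INR m + 1.
Proof.
move=> x0; have [up1 up2] := archimed x.
have up0 : (0 < up x)%Z by apply: lt_IZR; lra.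
exists (Z.to_nat (up x - 1)); rewrite INR_IZR_INZ Znat.Z2Nat.id; last by lia.
by rewrite minus_IZR; lra.
Qed.

Lemma Rdiv_le_iff (x y z : R) : 0 < z -> x / z <= y <-> x <= y * z.
Proof.
move=> z0; have E : x / z * z = x by field; lra.
split=> h; first by rewrite -E; apply: Rmult_le_compat_r; lra.
by apply: (Rmult_le_reg_r z); rewrite ?E.
Qed.

Lemma exp_le (x y : R) : x <= y -> exp x <= exp y.
Proof. by case=> [xy|->]; [left; apply: exp_increasing|right]. Qed.

(** Invert [1 / (1 - x) = 1 + x / (1 - x) <= exp (x / (1 - x))]. *)
Lemma exp_le_one_minus (x : R) : x < 1 -> exp (- (x / (1 - x))) <= 1 - x.
Proof.
move=> x1; rewrite exp_Ropp -[X in _ <= X]Rinv_inv.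
apply: Rinv_le_contravar; first by apply: Rinv_0_lt_compat; lra.
by apply: Rle_trans (exp_ineq1_le _); apply: Req_le; field; lra.
Qed.

Lemma exp_pow (t : R) (m : nat) : exp t ^ m = exp (INR m * t).
Proof.
elim: m => [|m IH]; first by rewrite /= Rmult_0_l exp_0.
by rewrite -tech_pow_Rmult IH -exp_plus S_INR; congr exp; ring.
Qed.

Lemma exp_ge_sqr (x : R) : 0 <= x -> x * x / 4 <= exp x.
Proof.
move=> x0; have h := exp_ineq1_le (x / 2).
have -> : exp x = exp (x / 2) * exp (x / 2) by rewrite -exp_plus; congr exp; field.
by nra.
Qed.

(* Writing [n = exp x], the right-hand side is in fact of order [n ^ delta]: the
   three factors cost [2 * a * delta], [a * c + delta] and [delta] in the exponent,
   out of the available [1 = a * c + (2 * a + 3) * delta]. *)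
Lemma mean_lower_bound (a c delta eta b x p : R) (m K n : nat) :
    let N := exp x in
    INR n = N -> p * N = a * x -> 0 < a -> 0 <= c <= 1 -> 0 < delta -> 0 <= x ->
    0 <= p <= 1 / 2 -> 2 * a * p <= delta -> a * c + (2 * a + 3) * delta = 1 ->
    delta * N / 2 <= INR m <= delta * N ->
    0 < b -> INR K <= eta * x -> - ln b * eta <= delta -> ln b <= 0 ->
  delta * delta * x / 8 <= INR m * ((1 - p) ^ m * (1 - p * c) ^ n * b ^ K / 4).
Proof.
move=> N nN pN a0 c01 d0 x0 p01 pd budget mN b0 Kx be lb.
have N0 : 0 < N by apply: exp_pos.
have pc : 0 <= p * c <= p by split; nra.
have A1 : exp (- (2 * a * delta * x)) <= (1 - p) ^ m.
  apply: (Rle_trans _ (exp (- (p / (1 - p))) ^ m)); last first.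
    by apply: pow_incr; split; [left; apply: exp_pos|apply: exp_le_one_minus; lra].
  rewrite exp_pow; apply: exp_le; have : p / (1 - p) <= 2 * p.
    by apply/Rdiv_le_iff; [lra|nra].
  have := pos_INR m; nra.
(* The main cost is [n * p * c = a * c * x]; the second-order remainder [2 * a * p * x] is at most
   [delta * x]. *)
have A2 : exp (- ((a * c + delta) * x)) <= (1 - p * c) ^ n.
  apply: (Rle_trans _ (exp (- (p * c / (1 - p * c))) ^ n)); last first.
    by apply: pow_incr; split; [left; apply: exp_pos|apply: exp_le_one_minus; lra].
  rewrite exp_pow nN; apply: exp_le.
  have : p * c / (1 - p * c) <= p * c + 2 * p * p by apply/Rdiv_le_iff; [lra|nra].
  move=> h; have : N * (p * c / (1 - p * c)) <= N * (p * c + 2 * p * p) by nra.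
  have -> : N * (p * c + 2 * p * p) = (a * x) * (c + 2 * p) by rewrite -pN; ring.
  have : 2 * a * p * x <= delta * x by nra.
  by nra.
have A3 : exp (- (delta * x)) <= b ^ K.
  rewrite -(exp_ln _ b0) exp_pow; apply: exp_le.
  have : INR K * - ln b <= eta * x * - ln b by apply: Rmult_le_compat_r; lra.
  by nra.
have e1 := exp_pos (- (2 * a * delta * x)).
have e2 := exp_pos (- ((a * c + delta) * x)).
have e3 := exp_pos (- (delta * x)).
have A12 := Rmult_le_compat _ _ _ _ (Rlt_le _ _ e1) (Rlt_le _ _ e2) A1 A2.
have A123 := Rmult_le_compat _ _ _ _ (Rlt_le _ _ (Rmult_lt_0_compat _ _ e1 e2)) (Rlt_le _ _ e3) A12 A3.
have dN : 0 <= delta * N / 2 by nra.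
have A := Rmult_le_compat _ _ _ _ dN
  (Rlt_le _ _ (Rmult_lt_0_compat _ _ (Rmult_lt_0_compat _ _ e1 e2) e3)) (proj1 mN) A123.
(* By the budget, the three costs leave exactly one [delta * x] of the exponent [x]. *)
have E : N * (exp (- (2 * a * delta * x)) * exp (- ((a * c + delta) * x)) *
    exp (- (delta * x))) = exp (delta * x).
  rewrite /N -!exp_plus; congr exp.
  have -> : a * c = 1 - (2 * a + 3) * delta by lra.
  by ring.
have W := exp_ineq1_le (delta * x).
move: A; set Z := exp _ * exp _ * exp _ in E *; set Q := _ * _ * b ^ K.
have -> : delta * N / 2 * Z = delta * (N * Z) / 2 by field.
have -> : INR m * (Q / 4) = INR m * Q / 4 by field.
by rewrite E; nra.
Qed.

Theorem theorem7 (a eps : R)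
  (ha : (0 < a)%R) (he0 : (0 <= eps)%R) (he1 : (eps <= 1/2)%R)
  (hth : (a * (sqrt (1 - eps) - sqrt eps) ^ 2 < 1)%R)
  (Yhat : forall n : nat, ('I_n -> 'I_n -> R) -> ('I_n -> 'I_n -> R)) :
  Un_cv (fun n => prob_exact a eps (Yhat n)) 0%R.
Proof.
set v := sqrt (1 - eps) in hth; set u := sqrt eps in hth.
have u0 : 0 <= u by apply: sqrt_pos.
have v0 : 0 < v by apply: sqrt_lt_R0; lra.
have uu : u * u = eps by apply: sqrt_sqrt.
have vv : v * v = 1 - eps by apply: sqrt_sqrt; lra.
have uv : u <= v by apply: sqrt_le_1_alt; lra.
(* Since [u ^ 2 + v ^ 2 = 1], [c] is [(v - u) ^ 2] and the threshold hypothesis reads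
   [a * c < 1]. *)
pose s := u * v; pose c := 1 - 2 * s.
have s0 : 0 <= s by rewrite /s; nra.
have s1 : 2 * s <= 1 by rewrite /s; nra.
have hc : a * c < 1.
  by have <- : (v - u) ^ 2 = c by rewrite /c /s /=; nra.
have [b b01 hb] : exists2 b : R, 0 < b <= 1 & forall K r w : nat, (r <= w <= r + K)%nat ->
    b ^ K * (s ^ r * s ^ w) <= (1 - eps) ^ r * eps ^ w.
  have [b /andP[/RltP b0 /RleP b1] hb] := tie_density (introT RleP u0)
    (introT RleP uv) (introT RltP v0).
  have u2 : u ^ 2 = eps by rewrite /= Rmult_1_r.
  have v2 : v ^ 2 = 1 - eps by rewrite /= Rmult_1_r.
  by exists b => // K r w /hb /RleP; rewrite -!RpowE v2 u2.
pose delta := (1 - a * c) / (2 * a + 3).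
have budget : a * c + (2 * a + 3) * delta = 1 by rewrite /delta; field; lra.
have ac0 : 0 <= a * c by rewrite /c; nra.
have d0 : 0 < delta by apply: Rdiv_lt_0_compat; lra.
have d1 : delta < 1 by nra.
have lb : ln b <= 0 by case: b01 => b0 [b1|->]; rewrite -ln_1; [left; apply: ln_increasing|right].
(* Chosen so that [K] close to [eta * ln n] costs at most a factor [n ^ delta] in [b ^ K]; the added
   1 keeps the denominator positive when [b = 1]. *)
pose eta := delta / (1 - ln b).
have eta0 : 0 < eta by apply: Rdiv_lt_0_compat; lra.
have be : - ln b * eta <= delta.
  have : eta * (1 - ln b) = delta by rewrite /eta; field; lra.
  by nra.
move=> tau tau0.
(* Each later lower bound on [x = ln n] is met by some of these positive summands. *)
pose X0 := 1 + 16 * a / (eta * eta) + 2 / eta + 8 * a + 8 * (a * a) / delta + 2 / delta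
  + 64 / (delta * delta * tau) + 64 / (delta * delta * (tau * tau)) + 64 * a / (tau * tau).
have ee : 0 < eta * eta by nra.
have dd : 0 < delta * delta by nra.
have tt : 0 < tau * tau by nra.
have ddt : 0 < delta * delta * tau by nra.
have ddtt : 0 < delta * delta * (tau * tau) by nra.
have c1 : 0 < 16 * a / (eta * eta) by apply: Rdiv_lt_0_compat; lra.
have c2 : 0 < 2 / eta by apply: Rdiv_lt_0_compat; lra.
have c3 : 0 < 8 * (a * a) / delta by apply: Rdiv_lt_0_compat; nra.
have c4 : 0 < 2 / delta by apply: Rdiv_lt_0_compat; lra.
have c5 : 0 < 64 / (delta * delta * tau) by apply: Rdiv_lt_0_compat; lra.
have c6 : 0 < 64 / (delta * delta * (tau * tau)) by apply: Rdiv_lt_0_compat; lra.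
have c7 : 0 < 64 * a / (tau * tau) by apply: Rdiv_lt_0_compat; lra.
have [N0 [_ hN0]] := nat_floor (Rlt_le _ _ (exp_pos X0)).
exists N0.+1 => n /ssrnat.leP nN0.
have nX : exp X0 < INR n.
  by apply: Rlt_le_trans hN0 _; rewrite -S_INR; apply: le_INR; apply/ssrnat.leP.
have n0 : 0 < INR n by have := exp_pos X0; lra.
pose x := ln (INR n).
have xX : X0 < x by rewrite -(ln_exp X0); apply: ln_increasing nX; apply: exp_pos.
have nx : INR n = exp x by rewrite /x exp_ln.
have div (y z : R) : 0 < z -> y / z <= x -> y <= x * z.
  by move=> z0 h; have : y / z * z <= x * z; [nra|rewrite /Rdiv Rmult_assoc Rinv_l; lra].
have h1 := div _ _ ee (ltac:(rewrite /X0 in xX; lra) : 16 * a / (eta * eta) <= x).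
have h2 := div _ _ eta0 (ltac:(rewrite /X0 in xX; lra) : 2 / eta <= x).
have x1 : 1 + 8 * a <= x by rewrite /X0 in xX; lra.
have h3 := div _ _ d0 (ltac:(rewrite /X0 in xX; lra) : 8 * (a * a) / delta <= x).
have h4 := div _ _ d0 (ltac:(rewrite /X0 in xX; lra) : 2 / delta <= x).
have h5 := div _ _ ddt (ltac:(rewrite /X0 in xX; lra) : 64 / (delta * delta * tau) <= x).
have h6 := div _ _ ddtt (ltac:(rewrite /X0 in xX; lra) : 64 / (delta * delta * (tau * tau)) <= x).
have h7 := div _ _ tt (ltac:(rewrite /X0 in xX; lra) : 64 * a / (tau * tau) <= x).
clear c1 c2 c3 c4 c5 c6 c7 xX; clearbody X0.
pose p := edge_prob a n.
have pN : p * INR n = a * x by rewrite /p /edge_prob -/x; field; lra.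
(* From [(ln n) ^ 2 <= 4 * n]; thus [p] is at most [4 * a / x]. *)
have px : p * x <= 4 * a.
  have h : x * x <= 4 * INR n by rewrite nx; have := @exp_ge_sqr x; lra.
  have : p * x * INR n <= 4 * a * INR n by have : a * (x * x) <= a * (4 * INR n); nra.
  by move=> h'; apply: Rmult_le_reg_r h'.
have p0 : 0 <= p.
  by apply: (Rmult_le_reg_r _ _ _ n0); rewrite pN; nra.
have p1 : p <= 1 / 2 by nra.
have pd : 2 * a * p <= delta.
  apply: (Rmult_le_reg_r x); first lra.
  by nra.
have nxx : x <= INR n by rewrite nx; have := exp_ineq1_le x; lra.
have [m [m1 m2]] := nat_floor (ltac:(nra) : 0 <= delta * INR n).
have m3 : delta * INR n / 2 <= INR m by nra.
have [K [K1 K2]] := nat_floor (ltac:(nra) : 0 <= eta * x).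
have K3 : eta * x / 2 <= INR K by nra.
have mean := @mean_lower_bound a c delta eta b x p m K n nx.
rewrite -nx in mean.
have {}mean := mean pN ha (ltac:(rewrite /c; lra)) d0 (ltac:(lra)) (conj p0 p1) pd budget
  (conj m3 m1) (proj1 b01) K1 be lb.
have m0 : (0 < m < n)%nat.
  apply/andP; split; apply/ssrnat.ltP; apply: INR_lt => /=; nra.
have K0 : (0 < K)%nat by apply/ssrnat.ltP; apply: INR_lt => /=; nra.
have ME : 1 - p + 2 * (p * s) = 1 - p * c by rewrite /c; ring.
(* The variance is at most [2 * a * x], while [K ^ 2] is at least [(eta * x / 2) ^ 2], of order
   [x ^ 2]. *)
have hK : INR n * (2 * (p * s) / (1 - p + 2 * (p * s))) / INR K ^ 2 <= 1 / 2.
  have M0 : 1 / 2 <= 1 - p + 2 * (p * s) by nra.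
  have K4 : eta * x / 2 * (eta * x / 2) <= INR K ^ 2 by rewrite /= Rmult_1_r; nra.
  have K5 : 0 < INR K ^ 2 by nra.
  apply/Rdiv_le_iff => //.
  have : 2 * (p * s) / (1 - p + 2 * (p * s)) <= 2 * p by apply/Rdiv_le_iff; nra.
  move=> h; have : INR n * (2 * (p * s) / (1 - p + 2 * (p * s))) <= INR n * (2 * p) by nra.
  have -> : INR n * (2 * p) = 2 * (a * x) by rewrite -pN; ring.
  have : x * (16 * a) <= x * (x * (eta * eta)) by nra.
  by nra.
have tau4 : 0 < tau / 4 by lra.
have plt1 : p < 1 by lra.
have he2 : eps <= 1 - eps by lra.
(* With [tau / 4] as the AM-GM parameter the three terms are at most [tau / 8], [tau / 4] and
   [tau / 4]. *)
have bound := @prob_exact_tilt_leR a eps s b (tau / 4) n m K (Yhat n) p0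
  plt1 he0 he2 s0 s1 (proj1 b01) tau4 m0 K0 (hb K) hK.
move: bound; rewrite -/p ME; set L := INR m * _ => bound.
have pos : 0 <= prob_exact a eps (Yhat n).
  by apply/RleP; apply: prob_exact_ge0; apply/RleP => //; apply: Rlt_le.
rewrite /R_dist Rminus_0_r Rabs_pos_eq //; apply: Rle_lt_trans bound _.
have y0 : 0 < delta * delta * x / 8 by nra.
have yL : / L <= / (delta * delta * x / 8) by apply: Rinv_le_contravar.
have y1 : / (delta * delta * x / 8) <= tau / 8.
  rewrite -[X in _ <= X]Rinv_inv; apply: Rinv_le_contravar.
    by apply: Rinv_0_lt_compat; lra.
  have -> : / (tau / 8) = 8 / tau by field; lra.
  by apply/Rdiv_le_iff; nra.
have y2 : / (delta * delta * x / 8) <= tau * tau / 8.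
  rewrite -[X in _ <= X]Rinv_inv; apply: Rinv_le_contravar.
    by apply: Rinv_0_lt_compat; lra.
  have -> : / (tau * tau / 8) = 8 / (tau * tau) by field; lra.
  by apply/Rdiv_le_iff; nra.
have y3 : p / (1 - p) <= tau * tau / 8.
  apply: (Rle_trans _ (2 * p)); first by apply/Rdiv_le_iff; nra.
  by apply: (Rmult_le_reg_r x); nra.
have : (/ L + p / (1 - p)) / (4 * (tau / 4)) <= tau / 4.
  by apply/Rdiv_le_iff; nra.
by lra.
Qed.
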